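(* Let $V_0$ be a finite dimensional real euclidean vector space with a basis $\Delta_0$, let $P\subset R\subset\Delta_0$, and let $\Lambda_1,\Lambda_2\in V_0$. Let $\boldsymbol B^{\Lambda_1,\Lambda_2}=\widehat{\boldsymbol\theta}{}^{\Lambda_2}\,\boldsymbol\theta^{\Lambda_1}$ (matrix product). Then, as functions on $V_0$, $$\boldsymbol B^{\Lambda_1,\Lambda_2}_{P,R}=(-1)^{a_P^{P_{\Lambda_1}}}\,\delta_{P_{\Lambda_1},R^{\Lambda_2}},$$ where $P_{\Lambda_1}=P^R_{\Lambda_1}$ and $R^{\Lambda_2}=R_P^{\Lambda_2}$ are the subsets with $P\subset P_{\Lambda_1}\subset R$ and $P\subset R^{\Lambda_2}\subset R$ defined by the pair $(P,R)$ and $\Lambda_1$, $\Lambda_2$ respectively, and $\delta_{S,S'}$ is $1$ if $S=S'$ and $0$ otherwise.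
   Context: Vectors of $V_0$ are regarded as linear forms via $\lambda(H)=\langle\lambda,H\rangle$. The basis $\Delta_0$ is not assumed obtuse. For subsets $P\subset Q\subset\Delta_0$: $\Delta_P^Q$ is the set of orthogonal projections of the elements of $Q\setminus P$ on the orthogonal complement of the span of $P$ (these are linearly independent, indexed by $Q\setminus P$); $V_P^Q$ is the span of $\Delta_P^Q$; $\widehat\Delta_P^Q\subset V_P^Q$ is the basis of $V_P^Q$ dual to $\Delta_P^Q$; $D_P^Q:\Delta_P^Q\to\widehat\Delta_P^Q$ is the canonical bijection ($\langle D_P^Q(\lambda),\lambda'\rangle=\delta_{\lambda,\lambda'}$); $a_P^Q$ is the cardinality of $\Delta_P^Q$, i.e. of $Q\setminus P$. For $P\subset S\subset Q$ one has $\Delta_P^S\subset\Delta_P^Q$ and $\widehat\Delta_S^Q\subset\widehat\Delta_P^Q$. Put $P_0=\emptyset$, so $a_{P_0}^P=|P|$. For $\Lambda\in V_0$ and $P\subset Q$: $\bullet$ $P_\Lambda=P_\Lambda^Q$ is the subset with $P\subset P_\Lambda\subset Q$ such that $\widehat\Delta_{P_\Lambda}^Q=\{\mu\in\widehat\Delta_P^Q\mid\mu(\Lambda)>0\}$; $Q^\Lambda=Q_P^\Lambda$ is the subset with $P\subset Q^\Lambda\subset Q$ such that $\Delta_P^{Q^\Lambda}=\{\lambda\in\Delta_P^Q\mid\lambda(\Lambda)>0\}$. $\bullet$ $\theta_{P,Q}^\Lambda$ is the characteristic function of the set of $H\in V_0$ such that for every $\lambda\in\Delta_P^Q$, with $\mu=D_P^Q(\lambda)$: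 $\lambda(H)\le0$ if $\mu(\Lambda)>0$, and $\lambda(H)>0$ otherwise. $\widehat\theta_{P,Q}^\Lambda$ is the characteristic function of the set of $H\in V_0$ such that for every $\lambda\in\Delta_P^Q$, with $\mu=D_P^Q(\lambda)$: $\mu(H)\le0$ if $\lambda(\Lambda)>0$, and $\mu(H)>0$ otherwise. In particular $\theta_{P,P}^\Lambda=\widehat\theta_{P,P}^\Lambda=1$; by convention $\theta_{P,Q}^\Lambda=\widehat\theta_{P,Q}^\Lambda=0$ if $P\not\subset Q$. $\bullet$ $b_{P,Q}^\Lambda$ is the number of $\mu\in\widehat\Delta_P^Q$ with $\mu(\Lambda)\le0$, $\widehat b_{P,Q}^\Lambda$ is the number of $\lambda\in\Delta_P^Q$ with $\lambda(\Lambda)\le0$. $\bullet$ $\boldsymbol\theta^\Lambda$ and $\widehat{\boldsymbol\theta}{}^\Lambda$ are the matrices indexed by pairs of subsets of $\Delta_0$, with entries functions on $V_0$: $\boldsymbol\theta^\Lambda_{P,Q}=(-1)^{|P|+b_{P,Q}^\Lambda}\theta_{P,Q}^\Lambda$ and $\widehat{\boldsymbol\theta}{}^\Lambda_{P,Q}=(-1)^{|P|+\widehat b_{P,Q}^\Lambda}\widehat\theta_{P,Q}^\Lambda$ if $P\subset Q$, and $0$ if $P\not\subset Q$. The product of matrices is $(\boldsymbol A\boldsymbol B)_{P,Q}=\sum_{R\subset\Delta_0}\boldsymbol A_{P,R}\boldsymbol B_{R,Q}$, with entries multiplied pointwise. *)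

(* Defs.v *)
From mathcomp Require Import all_boot all_order all_algebra.
From mathcomp Require Import classical_sets reals.

Set Implicit Arguments.
Unset Strict Implicit.
Unset Printing Implicit Defensive.

Import Order.TTheory GRing.Theory Num.Theory.
Local Open Scope ring_scope.

(* A euclidean space is a vectType with a positive definite symmetric form
   [dot]. The basis Delta_0 is a tuple [e], and a subset of Delta_0 is given by
   the set of the indices of its elements. Accordingly the members of Delta_P^Q
   and of its dual basis are indexed by [i \in Q :\: P]. *)
Section RootBases.
Variables (R : realType) (V : vectType R) (dot : {dot V for idfun}).
Variables (n : nat) (e : n.-tuple V).
Implicit Types (P Q S : {set 'I_n}) (L H : V) (i j : 'I_n).

Definition span_of P : {vspace V} := <<[seq tnth e i | i <- enum P]>>%VS.

Definition orth_proj P (v : V) : V :=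
  daddv_pi (orthov dot (span_of P)) (span_of P) v.

Definition proj_vec P i : V := orth_proj P (tnth e i).

Definition Delta P Q : seq V := [seq proj_vec P i | i <- enum (Q :\: P)].

Definition a_card P Q : nat := size (Delta P Q).

Definition V_ P Q : {vspace V} := <<Delta P Q>>%VS.

(* For [i \in Q :\: P], this is the image under D_P^Q of [proj_vec P i]; the
   default value 0 only matters when [e] is not free or [i \notin Q :\: P]. *)
Definition dual_vec P Q i : V :=
  xget 0 (fun v : V => v \in V_ P Q /\
    forall j, j \in Q :\: P -> dot v (proj_vec P j) = (i == j)%:R).

Definition hatDelta P Q : seq V := [seq dual_vec P Q i | i <- enum (Q :\: P)].

(* P_Lambda^Q; when [e] is a basis and [P \subset Q], exactly one [S] satisfies
   the condition, so that the default value is irrelevant. *)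
Definition lower_Lambda P Q L : {set 'I_n} :=
  xget P (fun S : {set 'I_n} => [/\ P \subset S, S \subset Q &
    hatDelta S Q =i [seq mu <- hatDelta P Q | 0 < dot mu L]]).

(* Q_P^Lambda, with the same remark. *)
Definition upper_Lambda P Q L : {set 'I_n} :=
  xget P (fun S : {set 'I_n} => [/\ P \subset S, S \subset Q &
    Delta P S =i [seq lambda <- Delta P Q | 0 < dot lambda L]]).

Definition theta L P Q H : R :=
  ((P \subset Q) && [forall i in Q :\: P,
     if 0 < dot (dual_vec P Q i) L then dot (proj_vec P i) H <= 0
     else 0 < dot (proj_vec P i) H])%:R.

Definition hattheta L P Q H : R :=
  ((P \subset Q) && [forall i in Q :\: P,
     if 0 < dot (proj_vec P i) L then dot (dual_vec P Q i) H <= 0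
     else 0 < dot (dual_vec P Q i) H])%:R.

Definition b_num L P Q : nat := count (fun mu => dot mu L <= 0) (hatDelta P Q).

Definition hatb_num L P Q : nat :=
  count (fun lambda => dot lambda L <= 0) (Delta P Q).

Definition fun_matrix := {set 'I_n} -> {set 'I_n} -> V -> R.

Definition fun_matrix_mul (A B : fun_matrix) : fun_matrix :=
  fun P Q H => \sum_(S : {set 'I_n}) A P S H * B S Q H.

Definition theta_matrix L : fun_matrix := fun P Q H =>
  if P \subset Q then (-1) ^+ (#|P| + b_num L P Q) * theta L P Q H else 0.

Definition hattheta_matrix L : fun_matrix := fun P Q H =>
  if P \subset Q then (-1) ^+ (#|P| + hatb_num L P Q) * hattheta L P Q H else 0.

Definition B_matrix L1 L2 : fun_matrix :=
  fun_matrix_mul (hattheta_matrix L2) (theta_matrix L1).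

End RootBases.

(* Main.v *)
(* Write N = R \ P, lambda_i for the elements of Delta_P^R and mu_i for the dual
   basis. Let C be the set of i with lambda_i(Lambda_2) > 0, and A the set of i
   with mu_i(Lambda_1) > 0. Identifying these sets with their indicators, the
   term of index S of the matrix product at H is
     prod_(i in S \ P) (a_S(i) - C(i)) * prod_(i in R \ S) (A(i) - b_S(i)),
   where a_S(i) and b_S(i) are the indicators of the positivity at H of the
   elements of hatDelta_P^S and of Delta_S^R. Neither depends on the remaining
   index of the pair, since hatDelta_S^Q is contained in hatDelta_P^Q, and
   Delta_S^Q in Delta_S^Q' for Q in Q'. The claim is that the sum over S equals
   prod_(i in N) (A(i) - C(i)).
     Changing A(i) from 0 to 1 changes the sum by the sum for (P, R \ i), and
   changing C(i) by minus the sum for (P u i, R). By induction on N, the two sides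
   vary alike with A and C, so it is enough to treat one pair (A, C), which
   may depend on H. When N is nonempty, take for C the i with lambda_i(H) > 0
   and for A the i with mu_i(H) > 0. Then both sides vanish: for dual bases
   (lambda_i) and (mu_i), sum_i lambda_i(H) mu_i(H) is the squared norm of a
   projection of H, so the conditions lambda_i(H) > 0 and mu_i(H) > 0 agree for
   at least one i. *)
Require Import Defs.
From mathcomp Require Import all_boot all_order all_algebra.
From mathcomp Require Import classical_sets reals.
(* Restores [subsetP] and other finset names shadowed by [classical_sets]. *)
From mathcomp Require Import fintype finset.
From mathcomp Require Import ring.

Set Implicit Arguments.
Unset Strict Implicit.
Unset Printing Implicit Defensive.

Import Order.TTheory GRing.Theory Num.Theory.
Local Open Scope ring_scope.

(** * Alternating sums over an interval of subsets *)

Section AlternatingSum.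
Variables (K : comPzRingType) (I : finType) (a b : {set I} -> I -> K).
Implicit Types (A C P R S : {set I}) (i : I).

Definition alternating_sum A C P R : K :=
  \sum_(S : {set I} | (P \subset S) && (S \subset R))
    ((\prod_(i in S :\: P) (a S i - (i \in C)%:R)) *
     (\prod_(i in R :\: S) ((i \in A)%:R - b S i))).

Lemma eq_alternating_sum A A' C C' P R :
  {in R :\: P, A =i A'} -> {in R :\: P, C =i C'} ->
  alternating_sum A C P R = alternating_sum A' C' P R.
Proof.
move=> eqA eqC; apply: eq_bigr => S /andP[PS SR].
congr (_ * _); apply: eq_bigr => i iS.
  by rewrite eqC // (subsetP _ _ iS) // setSD.
by rewrite eqA // (subsetP _ _ iS) // setDS.
Qed.

(** Terms with [i \in S] do not see whether [i \in A], and cancel. In the others the factor at [i]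
    passes from [- b S i] to [1 - b S i]; these are the [S] inside [R :\ i]. *)
Lemma alternating_sum_toggleA A C P R i : i \in R :\: P ->
  alternating_sum (i |: A) C P R - alternating_sum (A :\ i) C P R =
  alternating_sum A C P (R :\ i).
Proof.
move=> /setDP[iR iP].
rewrite /alternating_sum -sumrB (bigID (fun S : {set I} => i \in S)) /=.
rewrite big1 ?add0r => [|S /andP[_ iS]]; last first.
  rewrite -mulrBr [X in _ * X](_ : _ = 0) ?mulr0 //.
  apply/eqP; rewrite subr_eq0; apply/eqP/eq_bigr => j /setDP[_ jS].
  by rewrite !inE; case: eqVneq jS => // ->; rewrite iS.
apply: eq_big => [S|S /andP[/andP[PS SR] iS]]; first by rewrite subsetD1 andbA.
rewrite -mulrBr; congr (_ * _).
have iRS : i \in R :\: S by rewrite inE iS.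
rewrite !(bigD1 i iRS) /= !inE eqxx /=.
have E A' : A' \in [:: i |: A; A :\ i] ->
    \prod_(j in R :\: S | j != i) ((j \in A')%:R - b S j) =
    \prod_(j in (R :\ i) :\: S) ((j \in A)%:R - b S j).
  move=> A'E; apply: eq_big => [j|j /andP[_ ji]].
    by rewrite !inE andbC andbCA.
  by move: A'E; rewrite !inE => /orP[]/eqP->; rewrite !inE (negPf ji).
rewrite (E (i |: A)) ?(E (A :\ i)) ?inE ?eqxx ?orbT // -mulrBl.
by rewrite opprB addrA subrK subr0 mul1r.
Qed.

(** Here the terms with [i \notin S] cancel. In the others the factor at [i] drops by 1, and [S]
    contains [i |: P]. *)
Lemma alternating_sum_toggleC A C P R i : i \in R :\: P ->
  alternating_sum A (i |: C) P R - alternating_sum A (C :\ i) P R =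
  - alternating_sum A C (i |: P) R.
Proof.
move=> /setDP[iR iP].
rewrite /alternating_sum -sumrB (bigID (fun S : {set I} => i \in S)) /= addrC.
rewrite big1 ?add0r => [|S /andP[_ iS]]; last first.
  rewrite -mulrBl [X in X * _](_ : _ = 0) ?mul0r //.
  apply/eqP; rewrite subr_eq0; apply/eqP/eq_bigr => j /setDP[jS _].
  by rewrite !inE; case: eqVneq jS => // ->; rewrite (negPf iS).
rewrite -sumrN.
apply: eq_big => [S|S /andP[/andP[PS SR] iS]].
  by rewrite subUset sub1set andbC andbA.
rewrite -mulrBl -mulNr; congr (_ * _).
have iSP : i \in S :\: P by rewrite inE iP.
rewrite !(bigD1 i iSP) /= !inE eqxx /=.
have E C' : C' \in [:: i |: C; C :\ i] ->
    \prod_(j in S :\: P | j != i) (a S j - (j \in C')%:R) =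
    \prod_(j in S :\: (i |: P)) (a S j - (j \in C)%:R).
  move=> C'E; apply: eq_big => [j|j /andP[_ ji]].
    by rewrite !inE negb_or andbC andbA.
  by move: C'E; rewrite !inE => /orP[]/eqP->; rewrite !inE (negPf ji).
rewrite (E (i |: C)) ?(E (C :\ i)) ?inE ?eqxx ?orbT // -mulrBl.
by rewrite subr0 addrAC subrr add0r mulN1r.
Qed.

(** Any set is emptied by removing its elements one at a time. *)
Lemma toggle_invariant (T : Type) (h : {set I} -> T) :
  (forall A i, h (i |: A) = h (A :\ i)) -> forall A A', h A = h A'.
Proof.
move=> toggle; suff h0 A : h A = h set0 by move=> A A'; rewrite !h0.
have [m] := ubnP #|A|; elim: m A => // m IH A.
have [->//|[i iA]] := set_0Vmem A.
rewrite (cardsD1 i) iA ltnS => Am; rewrite -(IH (A :\ i)) // -toggle.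
by rewrite (setUidPr _) ?sub1set.
Qed.

Lemma alternating_sumE :
  (forall P R, P \proper R -> exists A C,
     alternating_sum A C P R = \prod_(i in R :\: P) ((i \in A)%:R - (i \in C)%:R)) ->
  forall A C P R, P \subset R ->
  alternating_sum A C P R = \prod_(i in R :\: P) ((i \in A)%:R - (i \in C)%:R).
Proof.
move=> base A C P R; have [m] := ubnP #|R :\: P|.
elim: m A C P R => // m IH A C P R; rewrite ltnS => RPm PR.
have [PR'|] := boolP (P \proper R); last first.
  rewrite properEneq PR andbT negbK => /eqP <-.
  rewrite /alternating_sum (big_pred1 P) => [|S]; last by rewrite /= eq_sym eqEsubset.
  by rewrite !setDv !big_set0 mulr1.
pose g A C := \prod_(i in R :\: P) ((i \in A)%:R - (i \in C)%:R) : K.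
(* [h] measures the failure of the identity. It is shown to be invariant under toggling [A] and [C],
   so its vanishing at the base pair spreads to all pairs. *)
pose h A C := alternating_sum A C P R - g A C.
have [A0 [C0 h0]] := base _ _ PR'.
apply/eqP; rewrite -subr_eq0 -/(g A C) -/(h A C); apply/eqP.
have lt_m i Q Q' : i \in R :\: P -> Q' :\: Q = (R :\: P) :\ i -> (#|Q' :\: Q| < m)%N.
  by move=> iRP ->; move: RPm; rewrite (cardsD1 i) iRP.
have gE i A' C' : i \in R :\: P ->
    g A' C' = ((i \in A')%:R - (i \in C')%:R) *
      \prod_(j in (R :\: P) :\ i) ((j \in A')%:R - (j \in C')%:R).
  move=> iRP; rewrite /g (bigD1 i) //=; congr (_ * _).
  by apply: eq_bigl => j; rewrite !inE andbC.
(* Equal variations of the two sides mean that their difference does not vary. *)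
have swap (x y z t : K) : x - y = z - t -> x - z = y - t.
  by move/eqP; rewrite subr_eq => /eqP->; rewrite addrAC [z - t - z]addrAC subrr add0r addrC.
have toggleA A' C' i : h (i |: A') C' = h (A' :\ i) C'.
  have [iRP|iRP] := boolP (i \in R :\: P); last first.
    have eqA : {in R :\: P, i |: A' =i A' :\ i}.
      by move=> j jRP; rewrite !inE; case: eqVneq jRP iRP => // -> ->.
    congr (_ - _); first exact: eq_alternating_sum.
    by apply: eq_bigr => j /eqA->.
  have [iR iP] := setDP iRP; apply: swap.
  have RiP : (R :\ i) :\: P = (R :\: P) :\ i by rewrite !setDDl setUC.
  rewrite alternating_sum_toggleA // IH ?(lt_m i) ?subsetD1 ?PR //.
  rewrite !(gE i) // !inE eqxx /= RiP.
  have E A'' : A'' \in [:: i |: A'; A' :\ i] ->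
      \prod_(j in (R :\: P) :\ i) ((j \in A'')%:R - (j \in C')%:R) =
      \prod_(j in (R :\: P) :\ i) ((j \in A')%:R - (j \in C')%:R) :> K.
    move=> A''E; apply: eq_bigr => j; rewrite in_setD1 => /andP[/negPf ji _].
    by move: A''E; rewrite !inE => /orP[]/eqP->; rewrite !inE ji.
  rewrite (E (i |: A')) ?(E (A' :\ i)) ?inE ?eqxx ?orbT // -mulrBl.
  by rewrite opprB addrA subrK subr0 mul1r.
have toggleC A' C' i : h A' (i |: C') = h A' (C' :\ i).
  have [iRP|iRP] := boolP (i \in R :\: P); last first.
    have eqC : {in R :\: P, i |: C' =i C' :\ i}.
      by move=> j jRP; rewrite !inE; case: eqVneq jRP iRP => // -> ->.
    congr (_ - _); first exact: eq_alternating_sum.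
    by apply: eq_bigr => j /eqC->.
  have [iR iP] := setDP iRP; apply: swap.
  have RiP : R :\: (i |: P) = (R :\: P) :\ i by rewrite !setDDl setUC.
  rewrite alternating_sum_toggleC // IH ?(lt_m i) ?subUset ?sub1set ?iR ?PR //.
  rewrite !(gE i) // !inE eqxx /= RiP.
  have E C'' : C'' \in [:: i |: C'; C' :\ i] ->
      \prod_(j in (R :\: P) :\ i) ((j \in A')%:R - (j \in C'')%:R) =
      \prod_(j in (R :\: P) :\ i) ((j \in A')%:R - (j \in C')%:R) :> K.
    move=> C''E; apply: eq_bigr => j; rewrite in_setD1 => /andP[/negPf ji _].
    by move: C''E; rewrite !inE => /orP[]/eqP->; rewrite !inE ji.
  rewrite (E (i |: C')) ?(E (C' :\ i)) ?inE ?eqxx ?orbT // -mulrBl.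
  by rewrite subr0 addrAC subrr add0r mulN1r.
rewrite (toggle_invariant (h := h^~ C) (fun A' i => toggleA A' C i) A A0).
rewrite (toggle_invariant (h := h A0) (toggleC A0) C C0).
by rewrite /h h0 subrr.
Qed.

End AlternatingSum.

(** * Orthogonal complements in a euclidean space *)

Section Euclidean.
Variables (K : realType) (V : vectType K) (dot : {dot V for idfun}).
Implicit Types (u v w : V) (s : seq V) (U : {vspace V}).

Lemma dotC u v : dot u v = dot v u.
Proof. by rewrite hermC expr0 mul1r. Qed.

Lemma dot0r u : dot u 0 = 0. Proof. exact: linear0r. Qed.

Lemma dotDr u v w : dot u (v + w) = dot u v + dot u w.
Proof. exact: linearDr. Qed.

Lemma dotBr u v w : dot u (v - w) = dot u v - dot u w.
Proof. exact: linearBr. Qed.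

Lemma dotZl a u v : dot (a *: u) v = a * dot u v.
Proof. exact: linearZl_LR. Qed.

Lemma dotBl u v w : dot (u - v) w = dot u w - dot v w.
Proof. exact: linearBl. Qed.

Lemma dot_suml I (r : seq I) (p : pred I) (F : I -> V) w :
  dot (\sum_(i <- r | p i) F i) w = \sum_(i <- r | p i) dot (F i) w.
Proof. by rewrite dotC linear_sumr; apply: eq_bigr => i _; exact: dotC. Qed.

Lemma dot_self_ge0 u : 0 <= dot u u.
Proof.
by have [->|/neq0_dnorm_gt0/ltW//] := eqVneq u 0; rewrite dot0r.
Qed.

Lemma dot_self_eq0 u : (dot u u == 0) = (u == 0).
Proof.
have [->|u0] := eqVneq u 0; first by rewrite dot0r eqxx.
by rewrite gt_eqF // neq0_dnorm_gt0.
Qed.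

Lemma mem_orthov_span s v :
  (forall u, u \in s -> dot v u = 0) -> v \in orthov dot <<s>>.
Proof.
move=> vs; rewrite mem_orthov_sym; apply/span_subvP => u us.
rewrite mem_orthov1; apply/eqP; exact: (etrans (dotC _ _) (vs _ us)).
Qed.

(** Gram-Schmidt by induction on [s]: the residue [w] of [v] is corrected along the residue [w'] of
    the new vector [u]. *)
Lemma orthov_complement s v :
  exists2 z, z \in <<s>>%VS & v - z \in orthov dot <<s>>.
Proof.
elim: s v => [|u s IH] v.
  exists 0; first exact: mem0v.
  by apply: mem_orthov_span.
have [z zs vz] := IH v; have [z' z's uz] := IH u.
set w := v - z in vz; set w' := u - z' in uz.
pose c := dot w w' / dot w' w'.
have sus : (<<s>> <= <<u :: s>>)%VS by rewrite span_cons addvSr.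
exists (z + c *: w').
  apply: rpredD; first exact: (subvP sus).
  apply/rpredZ/rpredB; last exact: (subvP sus).
  by rewrite memv_span ?mem_head.
rewrite opprD addrA -/w.
have ws : w - c *: w' \in orthov dot <<s>> by rewrite rpredB // rpredZ.
have ww : dot (w - c *: w') w' = 0.
  rewrite dotBl dotZl /c.
  (* If [w' = 0], then [c] is a quotient by 0, but the pairings with [w'] vanish whatever its
     value. *)
  have [w0|w0] := eqVneq w' 0; first by rewrite w0 !dot0r mulr0 subrr.
  by rewrite divfK ?subrr // dot_self_eq0.
apply: mem_orthov_span => x; rewrite inE => /orP[/eqP->|xs]; last first.
  by move/mem_orthovP: ws; apply; exact: memv_span.
rewrite -[u](subrK z') -/w' dotDr ww add0r.
by move/mem_orthovP: ws; apply.
Qed.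

Lemma orthov_cap s : (orthov dot <<s>> :&: <<s>> = 0)%VS.
Proof.
apply/eqP; rewrite -subv0; apply/subvP => x /memv_capP[/mem_orthovP xo xs].
by rewrite memv0 -dot_self_eq0 xo.
Qed.

(** * Projections attached to subsets of the basis *)

Variables (n : nat) (e : n.-tuple V).
Implicit Types (P Q S : {set 'I_n}) (i j : 'I_n).

Lemma mem_span_of P i : i \in P -> tnth e i \in span_of e P.
Proof. by move=> iP; apply/memv_span/map_f; rewrite mem_enum. Qed.

Lemma span_of_sub P Q : P \subset Q -> (span_of e P <= span_of e Q)%VS.
Proof.
move=> PQ; apply/sub_span => _ /mapP[i iP ->]; rewrite map_f //.
by move: iP; rewrite !mem_enum; exact: (subsetP PQ).
Qed.

Lemma orth_proj_orth P v x :
  x \in span_of e P -> dot (orth_proj dot e P v) x = 0.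
Proof. by apply/mem_orthovP; exact: memv_pi. Qed.

Lemma sub_orth_proj P v : v - orth_proj dot e P v \in span_of e P.
Proof.
rewrite -{1}(daddv_pi_add (orthov_cap [seq tnth e i | i <- enum P]) (w := v)).
  by rewrite /orth_proj addrAC subrr add0r memv_pi.
have [z zs vz] := orthov_complement [seq tnth e i | i <- enum P] v.
by rewrite -[v](subrK z) memv_add.
Qed.

Lemma orth_proj_id P v :
  (forall x, x \in span_of e P -> dot v x = 0) -> orth_proj dot e P v = v.
Proof. by move=> /mem_orthovP vP; apply: daddv_pi_id => //; exact: orthov_cap. Qed.

Lemma orth_proj_span P v : v \in span_of e P -> orth_proj dot e P v = 0.
Proof.
move=> vP; apply/eqP; rewrite -dot_self_eq0 orth_proj_orth //.
by rewrite -[X in X \in _](subKr v) rpredB // sub_orth_proj.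
Qed.

Lemma dot_orth_proj P v w :
  (forall x, x \in span_of e P -> dot v x = 0) ->
  dot v (orth_proj dot e P w) = dot v w.
Proof.
move=> vP; apply/eqP; rewrite eq_sym -subr_eq0 -dotBr vP //.
exact: sub_orth_proj.
Qed.

(** Such a [v] is its own projection, and the projection sends the generators of [span_of e Q] to
    [Delta dot e P Q], except those indexed by [P], which it kills. *)
Lemma mem_V_ P Q v : v \in span_of e Q ->
  (forall x, x \in span_of e P -> dot v x = 0) -> v \in V_ dot e P Q.
Proof.
move=> vQ vP; rewrite -(orth_proj_id vP).
have := memv_img (daddv_pi (orthov dot (span_of e P)) (span_of e P)) vQ.
rewrite limg_span -map_comp; apply/subvP/span_subvP => _ /mapP[i iQ ->] /=.
have [iP|iP] := boolP (i \in P).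
  by rewrite [X in X \in _](orth_proj_span (mem_span_of iP)) mem0v.
apply: memv_span; apply/mapP; exists i => //.
by move: iQ; rewrite !mem_enum in_setD iP.
Qed.

Lemma V_eq0 P Q v : v \in V_ dot e P Q ->
  (forall j, j \in Q :\: P -> dot v (proj_vec dot e P j) = 0) -> v = 0.
Proof.
move=> vV v0; apply/eqP; rewrite -dot_self_eq0; apply/eqP.
suff /mem_orthovP-> : v \in orthov dot (V_ dot e P Q) by [].
by apply: mem_orthov_span => _ /mapP[j jQ ->]; rewrite v0 // -mem_enum.
Qed.

(* [dual_vec P Q i] is a positive multiple of [altitude Q i] whatever [P] is. *)
Definition altitude Q i : V := orth_proj dot e (Q :\ i) (tnth e i).

(** * Dual bases and the signs of their pairings with a vector *)

Hypothesis free_e : free e.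

(** Otherwise [tnth e i] would lie in [span_of e (Q :\ i)], on which the [i]-th coordinate form
    vanishes. *)
Lemma altitude_neq0 Q i : altitude Q i != 0.
Proof.
apply/eqP => a0; have := sub_orth_proj (Q :\ i) (tnth e i).
rewrite -/(altitude Q i) a0 subr0 => eQ.
have ci (j : 'I_n) : coord e i (tnth e j) = (i == j)%:R.
  by rewrite (tnth_nth 0) coord_free // eq_sym.
have /subvP/(_ _ eQ) : (span_of e (Q :\ i) <= lker (linfun (coord e i : V -> K^o)))%VS.
  apply/span_subvP => _ /mapP[j jQ ->]; rewrite memv_ker lfunE /= ci.
  by move: jQ; rewrite mem_enum !inE eq_sym => /andP[/negPf-> _].
by rewrite memv_ker lfunE /= ci eqxx oner_eq0.
Qed.

(** The altitude is orthogonal to the span of [P], so it pairs with [proj_vec P j] as with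
    [tnth e j]: this gives 0 for [j != i], and its own squared norm for [j = i]. *)
Lemma scaled_altitudeP P Q i (v := altitude Q i) : P \subset Q -> i \in Q :\: P ->
  (dot v v)^-1 *: v \in V_ dot e P Q /\ forall j, j \in Q :\: P ->
    dot ((dot v v)^-1 *: v) (proj_vec dot e P j) = (i == j)%:R.
Proof.
move=> PQ /setDP[iQ iP].
have vQi x : x \in span_of e (Q :\ i) -> dot v x = 0 by exact: orth_proj_orth.
have vP x : x \in span_of e P -> dot v x = 0.
  move=> xP; apply/vQi/(subvP _ _ xP)/span_of_sub/subsetP => j jP.
  by rewrite !inE (subsetP PQ) // andbT; apply: contraNneq iP => <-.
have vQ : v \in span_of e Q.
  rewrite -(subKr (tnth e i) v); apply: rpredB; first exact: mem_span_of.
  by apply: (subvP (span_of_sub (subD1set Q i))); exact: sub_orth_proj.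
split=> [|j /setDP[jQ jP]]; first by rewrite rpredZ // mem_V_.
rewrite dotZl (dot_orth_proj (tnth e j) vP); have [<-|ij] := eqVneq i j; last first.
  by rewrite (vQi (tnth e j)) ?mulr0 // mem_span_of // !inE eq_sym ij.
have -> : dot v (tnth e i) = dot v v.
  by apply/eqP; rewrite -subr_eq0 -dotBr vQi // sub_orth_proj.
by rewrite mulVf // dot_self_eq0 altitude_neq0.
Qed.

Lemma dual_vecE P Q i (v := altitude Q i) : P \subset Q -> i \in Q :\: P ->
  dual_vec dot e P Q i = (dot v v)^-1 *: v.
Proof.
move=> PQ iQP; have vdual := scaled_altitudeP PQ iQP.
apply: xget_unique => [//|u [uV udual]]; apply: subr0_eq.
apply: (@V_eq0 P Q); first by rewrite rpredB //; case: vdual.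
by move=> j jQP; rewrite dotBl udual // vdual.2 // subrr.
Qed.

Lemma mem_dual_vec P Q i : P \subset Q -> i \in Q :\: P ->
  dual_vec dot e P Q i \in V_ dot e P Q.
Proof. by move=> PQ iQP; rewrite dual_vecE //; case: (scaled_altitudeP PQ iQP). Qed.

Lemma dot_dual_proj P Q i j : P \subset Q -> i \in Q :\: P -> j \in Q :\: P ->
  dot (dual_vec dot e P Q i) (proj_vec dot e P j) = (i == j)%:R.
Proof.
by move=> PQ iQP; rewrite dual_vecE //; case: (scaled_altitudeP PQ iQP) => _; exact.
Qed.

Lemma dual_vec_lower P S Q i : P \subset S -> S \subset Q -> i \in Q :\: S ->
  dual_vec dot e S Q i = dual_vec dot e P Q i.
Proof.
move=> PS SQ iQS; rewrite !dual_vecE //; first exact: subset_trans SQ.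
by apply: (subsetP _ _ iQS); exact: setDS.
Qed.

(** Pairing with the dual basis recovers the index: [i == j] is read as positivity of a Kronecker
    delta. *)
Lemma proj_vec_inj P Q : P \subset Q -> {in Q :\: P &, injective (proj_vec dot e P)}.
Proof.
move=> PQ i j iQP jQP eq_ij; apply/eqP; rewrite -[_ == _]lt0b -(ltr0n K).
by rewrite -(dot_dual_proj PQ iQP jQP) -eq_ij dot_dual_proj // eqxx ltr01.
Qed.

Lemma dual_vec_inj P Q : P \subset Q -> {in Q :\: P &, injective (dual_vec dot e P Q)}.
Proof.
move=> PQ i j iQP jQP eq_ij; apply/eqP; rewrite -[_ == _]lt0b -(ltr0n K).
by rewrite -(dot_dual_proj PQ iQP jQP) eq_ij dot_dual_proj // eqxx ltr01.
Qed.

(** The products sum to the squared norm of the projection of [H] on [V_ P Q]. If none is positive,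
    this projection is zero, hence so are all the pairings. *)
Lemma proj_dual_eq0 P Q H : P \subset Q ->
  (forall i, i \in Q :\: P ->
     dot (dual_vec dot e P Q i) H * dot (proj_vec dot e P i) H <= 0) ->
  forall i, i \in Q :\: P ->
    dot (dual_vec dot e P Q i) H = 0 /\ dot (proj_vec dot e P i) H = 0.
Proof.
move=> PQ le0.
set M := dual_vec dot e P Q; set L := proj_vec dot e P.
pose x := \sum_(j in Q :\: P) dot (M j) H *: L j.
(* [x] is the orthogonal projection of [H] on [V_ P Q]. *)
have LE k : k \in Q :\: P -> L k = \sum_(j in Q :\: P) dot (L j) (L k) *: M j.
  move=> kQP; apply: subr0_eq; apply: (@V_eq0 P Q) => [|m mQP].
    rewrite rpredB ?rpred_sum // => [|j jQP]; last by rewrite rpredZ ?mem_dual_vec.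
    by apply: memv_span; rewrite map_f // mem_enum.
  rewrite dotBl dot_suml (bigD1 m) //= dotZl dot_dual_proj // eqxx mulr1.
  rewrite big1 => [|j /andP[jQP jm]]; first by rewrite addr0 dotC subrr.
  by rewrite dotZl dot_dual_proj // (negPf jm) mulr0.
have xL k : k \in Q :\: P -> dot x (L k) = dot (L k) H.
  move=> kQP; rewrite [in RHS]LE // !dot_suml; apply: eq_bigr => j _.
  by rewrite !dotZl mulrC.
have xM k : k \in Q :\: P -> dot x (M k) = dot (M k) H.
  move=> kQP; rewrite dot_suml (bigD1 k) //= dotZl dotC dot_dual_proj //.
  rewrite eqxx mulr1 big1 ?addr0 // => j /andP[jQP jk].
  by rewrite dotZl dotC dot_dual_proj // eq_sym (negPf jk) mulr0.
have x0 : x = 0.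
  apply/eqP; rewrite -dot_self_eq0 eq_le dot_self_ge0 andbT.
  rewrite {1}/x dot_suml; apply: sumr_le0 => j jQP.
  by rewrite dotZl (dotC (L j)) xL // le0.
by move=> i iQP; rewrite -xM // -xL // x0 dotC dot0r dotC dot0r.
Qed.

Lemma dot_dual_vec_gt0 P Q i x : P \subset Q -> i \in Q :\: P ->
  (0 < dot (dual_vec dot e P Q i) x) = (0 < dot (altitude Q i) x).
Proof.
move=> PQ iQP; rewrite dual_vecE // dotZl pmulr_rgt0 // invr_gt0.
by rewrite neq0_dnorm_gt0 // altitude_neq0.
Qed.

Lemma exists_same_sign P Q H : P \proper Q ->
  exists2 i, i \in Q :\: P &
    (0 < dot (altitude Q i) H) = (0 < dot (proj_vec dot e P i) H).
Proof.
move=> /properP[PQ [k kQ kP]]; have kQP : k \in Q :\: P by rewrite inE kP.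
have [/exists_inP[i iQP /eqP]|] := boolP [exists i in Q :\: P,
  (0 < dot (altitude Q i) H) == (0 < dot (proj_vec dot e P i) H)]; first by exists i.
rewrite negb_exists_in => /forall_inP opposite.
(* If the signs disagree everywhere, all products are nonpositive; then both pairings at [k] are
   zero, so neither is positive and they agree after all. *)
have [i iQP|d0 p0] := proj_dual_eq0 PQ (H := H) _ kQP; last first.
  by exists k; rewrite // -(dot_dual_vec_gt0 _ PQ kQP) d0 p0.
have := opposite i iQP; rewrite -(dot_dual_vec_gt0 _ PQ iQP).
have [d0|d0] := ltP 0 (dot (dual_vec dot e P Q i) H);
  have [p0|p0] // := ltP 0 (dot (proj_vec dot e P i) H) => _.
  by rewrite pmulr_rle0.
by rewrite mulr_le0_ge0 // ltW.
Qed.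

Lemma cone_sumE (A C P R : {set 'I_n}) H : P \subset R ->
  alternating_sum (fun S i => (0 < dot (altitude S i) H)%R%:R : K)
    (fun S i => (0 < dot (proj_vec dot e S i) H)%R%:R : K) A C P R =
  \prod_(i in R :\: P) ((i \in A)%:R - (i \in C)%:R).
Proof.
apply: alternating_sumE => {A C P R} P R PR.
exists [set i | 0 < dot (altitude R i) H], [set i | 0 < dot (proj_vec dot e P i) H].
have [i iRP signs] := exists_same_sign H PR.
rewrite [RHS](bigD1 i) //= !inE signs subrr mul0r.
(* Every term has a zero factor: in the product over [S :\: P] if [P] is proper in [S], and in the
   product over [R :\: S] if [S = P]. *)
apply: big1 => S /andP[PS SR]; have [PS'|] := boolP (P \proper S).
  have [j jSP signj] := exists_same_sign H PS'.
  by rewrite (bigD1 j) //= !inE signj subrr !mul0r.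
rewrite properEneq PS andbT negbK => /eqP PE; subst S.
have [j jRP signj] := exists_same_sign H PR.
by rewrite (bigD1 (op := *%R) (P := fun i => i \in R :\: P) j) //= !inE signj subrr mul0r mulr0.
Qed.

(** * Index sets of the subsets defined by Lambda *)

Lemma map_enum_filterE (f : 'I_n -> V) (p : pred V) (S T : {set 'I_n}) :
  {in T &, injective f} -> S \subset T ->
  [seq f i | i <- enum S] =i [seq x <- [seq f i | i <- enum T] | p x] <->
  S = [set i in T | p (f i)].
Proof.
move=> f_inj ST; split=> [eq_f|SE x].
  apply/setP => i; rewrite inE.
  have [iT|iT] /= := boolP (i \in T); last first.
    by apply: contraNF iT; exact: (subsetP ST).
  have in_f (U : {set 'I_n}) : U \subset T -> (f i \in [seq f j | j <- enum U]) = (i \in U).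
    move=> UT; apply/mapP/idP => [[j]|iU]; last by exists i; rewrite // mem_enum.
    by rewrite mem_enum => jU /f_inj-> //; exact: (subsetP UT).
  by rewrite -(in_f S) // eq_f mem_filter in_f // iT andbT.
rewrite SE mem_filter; apply/mapP/andP => [[i]|[px /mapP[i]]].
  by rewrite mem_enum inE => /andP[iT pi] ->; rewrite pi map_f // mem_enum.
by rewrite mem_enum => iT xE; exists i; rewrite // mem_enum inE iT -xE.
Qed.

(** Since [proj_vec] is injective on [Q :\: P], the defining condition on vectors becomes
    [S :\: P = T] on indices, which has exactly one solution between [P] and [Q]. *)
Lemma upper_LambdaE P Q L : P \subset Q ->
  upper_Lambda dot e P Q L = P :|: [set i in Q :\: P | 0 < dot (proj_vec dot e P i) L].
Proof.
move=> PQ; set T := [set i in _ | _].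
have TE S : S \subset Q -> Delta dot e P S =i
    [seq lambda <- Delta dot e P Q | 0 < dot lambda L] <-> S :\: P = T.
  move=> SQ; apply: map_enum_filterE; last exact: setSD.
  exact: proj_vec_inj.
have TQP : T \subset Q :\: P by apply/subsetP => i; rewrite inE => /andP[].
apply: xget_unique => [|S [PS SQ /TE <- //]]; last first.
  by rewrite setDE setUIr setUCr setIT; apply/esym/setUidPr.
have PTQ : P :|: T \subset Q.
  by rewrite subUset PQ (subset_trans TQP) // subsetDl.
split=> //; first exact: subsetUl.
apply/TE => //; rewrite setDUl setDv set0U; apply/setDidPl.
by rewrite disjoint_sym; move: TQP; rewrite subsetD disjoint_sym => /andP[].
Qed.

Lemma lower_LambdaE P Q L : P \subset Q ->
  lower_Lambda dot e P Q L =
  Q :\: [set i in Q :\: P | 0 < dot (dual_vec dot e P Q i) L].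
Proof.
move=> PQ; set T := [set i in _ | _].
have TE S : P \subset S -> S \subset Q -> hatDelta dot e S Q =i
    [seq mu <- hatDelta dot e P Q | 0 < dot mu L] <-> Q :\: S = T.
  move=> PS SQ; rewrite /hatDelta.
  (* Raising the lower index keeps the dual vectors, so both lists come from one injective
     family. *)
  have -> : [seq dual_vec dot e S Q i | i <- enum (Q :\: S)] =
            [seq dual_vec dot e P Q i | i <- enum (Q :\: S)].
    by apply/eq_in_map => i; rewrite mem_enum => iQS; exact: dual_vec_lower.
  apply: map_enum_filterE; last exact: setDS.
  exact: dual_vec_inj.
have TQP : T \subset Q :\: P by apply/subsetP => i; rewrite inE => /andP[].
apply: xget_unique => [|S [PS SQ /(TE _ PS SQ) <-]]; last first.
  by rewrite setDDr setDv set0U; apply/esym/setIidPr.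
have PQT : P \subset Q :\: T.
  by rewrite subsetD PQ disjoint_sym; move: TQP; rewrite subsetD => /andP[].
split=> //; first exact: subsetDl.
apply/TE => //; first exact: subsetDl.
rewrite setDDr setDv set0U; apply/setIidPr/(subset_trans TQP).
exact: subsetDl.
Qed.

(** * Matrix entries as products over indices *)

Lemma natr_forall (S : {set 'I_n}) (p : pred 'I_n) :
  [forall i in S, p i]%:R = \prod_(i in S) (p i)%:R :> K.
Proof.
have [/forall_inP pS|] := boolP [forall i in S, p i].
  by rewrite big1 // => i /pS ->.
by rewrite negb_forall_in => /exists_inP[i iS /negPf pi]; rewrite (bigD1 i) //= pi mul0r.
Qed.

Lemma sign_count (f : 'I_n -> V) (p : pred V) (S : {set 'I_n}) :
  (-1) ^+ count p [seq f i | i <- enum S] = \prod_(i in S) (-1) ^+ p (f i) :> K.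
Proof.
rewrite -big_enum /=; elim: (enum S) => [|i s IH]; first by rewrite big_nil.
by rewrite /= exprD IH big_cons.
Qed.

(** The signs of [#|P|] and [#|S|] combine into one factor -1 for each [i] in [S :\: P]. The
    identity then holds factor by factor, by cases on two signs. *)
Lemma matrix_termE P S (R : {set 'I_n}) L1 L2 H : P \subset S -> S \subset R ->
  hattheta_matrix dot e L2 P S H * theta_matrix dot e L1 S R H =
  (\prod_(i in S :\: P) ((0 < dot (altitude S i) H)%R%:R -
     (i \in [set i | 0 < dot (proj_vec dot e P i) L2])%:R)) *
  (\prod_(i in R :\: S) ((i \in [set i | 0 < dot (altitude R i) L1])%:R -
     (0 < dot (proj_vec dot e S i) H)%R%:R)).
Proof.
move=> PS SR; rewrite /hattheta_matrix /theta_matrix /hattheta /theta PS SR /=.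
have sign_card : (-1) ^+ #|S| = (-1) ^+ #|P| * \prod_(i in S :\: P) (-1) :> K.
  by rewrite prodr_const -exprD -{1}(cardsID P S) (setIidPr PS).
rewrite !exprD sign_card !natr_forall !sign_count.
have sq (x y z t u w : K) : x * x = 1 ->
  x * y * z * (x * t * u * w) = (t * y * z) * (u * w).
  by move=> xx; rewrite -[t * y * z]mul1r -xx; ring.
rewrite sq -?expr2 ?sqrr_sign // -!big_split /=.
congr (_ * _); apply: eq_bigr => i iS; rewrite !inE.
  rewrite !leNgt dot_dual_vec_gt0 //.
  case: (0 < dot (proj_vec _ _ _ _) _); case: (0 < dot _ _) => /=;
  by rewrite ?expr0 ?expr1 ?mulr1 ?mulr0 ?mulrNN ?subrr ?subr0 ?sub0r ?mulr1.
rewrite !leNgt dot_dual_vec_gt0 //.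
case: (0 < dot (altitude _ _) _); case: (0 < dot _ _) => /=;
by rewrite ?expr0 ?expr1 ?mulr1 ?mulr0 ?subrr ?subr0 ?sub0r.
Qed.

End Euclidean.

(** * Evaluation of the matrix product *)

Theorem proposition3p4 (K : realType) (V0 : vectType K) (dot : {dot V0 for idfun})
    (n : nat) (Delta0 : n.-tuple V0) (hDelta0 : basis_of fullv Delta0)
    (P R : {set 'I_n}) (hPR : P \subset R) (L1 L2 : V0) :
  forall H : V0,
    B_matrix dot Delta0 L1 L2 P R H =
    (-1) ^+ a_card dot Delta0 P (lower_Lambda dot Delta0 P R L1)
      * (lower_Lambda dot Delta0 P R L1 == upper_Lambda dot Delta0 P R L2)%:R.
Proof.
move=> H; have free_e := basis_free hDelta0.
rewrite /B_matrix /fun_matrix_mul.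
rewrite (bigID (fun S : {set 'I_n} => (P \subset S) && (S \subset R))) /=.
rewrite [X in _ + X]big1 ?addr0 => [|S]; last first.
  rewrite /hattheta_matrix /theta_matrix.
  by case: (P \subset S); case: (S \subset R); rewrite ?mul0r ?mulr0.
transitivity (alternating_sum
    (fun S i => (0 < dot (altitude dot Delta0 S i) H)%R%:R : K)
    (fun S i => (0 < dot (proj_vec dot Delta0 S i) H)%R%:R : K)
    [set i | 0 < dot (altitude dot Delta0 R i) L1]
    [set i | 0 < dot (proj_vec dot Delta0 P i) L2] P R).
  by apply: eq_bigr => S /andP[PS SR]; exact: matrix_termE.
rewrite cone_sumE //.
rewrite lower_LambdaE // upper_LambdaE //.
set lower := R :\: [set i in _ | _]; set upper := P :|: _.
have lowE i : i \in R :\: P -> (i \in lower) = ~~ (0 < dot (altitude dot Delta0 R i) L1).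
  move=> iRP; rewrite !inE dot_dual_vec_gt0 //.
  by move: iRP; rewrite inE => /andP[-> ->]; rewrite andbT.
have upE i : i \in R :\: P -> (i \in upper) = (0 < dot (proj_vec dot Delta0 P i) L2).
  by rewrite !inE => /andP[/negPf-> ->].
(* On [R :\: P], [lower] is the complement of the set [A] and [upper] is the set [C], so the factor
   at [i] is zero exactly when [lower] and [upper] differ there. *)
have [/exists_inP[i iRP]|] := boolP [exists i in R :\: P,
    (i \in lower) != (i \in upper)].
  rewrite lowE // upE // => signs; rewrite (bigD1 i) //= !inE.
  have /negPf-> : lower != upper.
    by apply: contraNneq signs => lu; rewrite -lowE // -upE // lu.
  by move: signs; do 2![case: (0 < _)] => // _; rewrite subrr mul0r mulr0.
rewrite negb_exists_in => /forall_inP same.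
have lower_upper : lower = upper.
  apply/setP => i; have [/same/negPn/eqP//|] := boolP (i \in R :\: P).
  rewrite !inE negb_and negbK => /orP[iP|/negPf iR].
    by rewrite iP /= (subsetP hPR).
  by rewrite iR !andbF orbF; apply/esym/negbTE; apply: contraFN iR; exact: (subsetP hPR).
(* When they coincide, the factor is -1 on [lower :\: P] and 1 on the rest of [R :\: P]. *)
rewrite lower_upper eqxx mulr1 -lower_upper /a_card size_map -cardE -prodr_const.
rewrite [RHS](eq_bigl (fun i => (i \in R :\: P) && (i \in lower))) => [|i]; last first.
  by rewrite !inE; case: (i \in P); case: (i \in R); rewrite ?andbF ?andbT.
rewrite big_mkcondr; apply: eq_bigr => i iRP.
have := same i iRP; rewrite negbK lowE // upE // !inE => /eqP <-.
by case: (0 < _); rewrite ?subr0 ?sub0r.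
Qed.
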